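(* Let $h>0$, let $A_h=\frac{1}{h^2}[-1\ \ 2\ \ -1]$ be the three-point discrete Laplacian on the infinite one-dimensional grid $h\mathbb{Z}$, let $M_v$ be the vertex-wise additive Vanka operator for $A_h$, and let $S_v=I-\omega M_vA_h$, $\omega\in\mathbb{R}$. Let $\widetilde{A}_h(\theta)$ and $\widetilde{M}_v(\theta)$ denote the symbols of $A_h$ and $M_v$, and let $T^{\rm high}=[-\frac{\pi}{2},\frac{3\pi}{2})\setminus[-\frac{\pi}{2},\frac{\pi}{2})$. Then the optimal smoothing factor of $S_v$ is $$\mu_{v,\rm opt}=\min_{\omega\in\mathbb{R}}\ \max_{\theta\in T^{\rm high}}\left|1-\omega\,\widetilde{M}_v(\theta)\widetilde{A}_h(\theta)\right|=\frac{1}{26},$$ and the minimum over $\omega$ is uniquely achieved at $\omega=\frac{81}{104}$.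
   Context: Grid functions are functions $u:h\mathbb{Z}\to\mathbb{C}$. A stencil $[s_{k}]_{k}$ (finitely many nonzero entries, the centre entry being $k=0$) defines the operator $(Su)(x)=\sum_k s_k\,u(x+kh)$. The symbol of such an operator $S$ is the function $\widetilde{S}(\theta)$ with $S e^{\iota\theta x/h}=\widetilde{S}(\theta)e^{\iota\theta x/h}$, where $\iota^2=-1$. Additive Vanka operator: given a family of finite subsets (patches) $\Upsilon_i$ of the grid whose union is the whole grid, let $V_i$ be the restriction of a grid function to $\Upsilon_i$, $V_i^T$ its transpose (extension by zero), and $A_i=V_iA_hV_i^T$. Then $M=\sum_i V_i^T W_i A_i^{-1}V_i$, where $W_i$ is the diagonal matrix whose entry at each grid point of $\Upsilon_i$ is the reciprocal of the number of patches containing that grid point. The vertex-wise Vanka operator $M_v$ in one dimension uses the patches $\{x_{j-1},x_j,x_{j+1}\}$, $x_j=jh$, $j\in\mathbb{Z}$ (so $A_i=\frac{1}{h^2}\begin{pmatrix}2&-1&0\\-1&2&-1\\0&-1&2\end{pmatrix}$ and $W_i=\frac13 I$). *)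

(* Defs.v *)
From HB Require Import structures.
From mathcomp Require Import all_boot all_order all_algebra finmap complex.
From mathcomp Require Import all_classical all_reals all_analysis.

Set Implicit Arguments.
Unset Strict Implicit.
Unset Printing Implicit Defensive.

Import Order.TTheory GRing.Theory Num.Theory.

Local Open Scope classical_set_scope.
Local Open Scope ring_scope.
Local Open Scope complex_scope.

(* A grid function u : hZ -> C is represented by j |-> u(jh), so that the
   shift x |-> x + kh becomes j |-> j + k. *)
Definition grid_fun (R : realType) := int -> R[i].

Definition grid_op (R : realType) := grid_fun R -> grid_fun R.

Definition gridpt (R : realType) (h : R) (j : int) : R := j%:~R * h.

Definition stencil (R : realType) := {fsfun int -> R[i] with 0}.

Definition stencil_op (R : realType) (s : stencil R) : grid_op R :=
  fun u j => \sum_(k <- finsupp s) s k * u (j + k).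

Definition laplace_stencil (R : realType) (h : R) : stencil R :=
  [fsfun k in [fset (-1)%Z; 0%Z; 1%Z]%fset =>
     ((if k == 0 then 2 else -1) / h ^+ 2)%:C].

Definition laplace (R : realType) (h : R) : grid_op R :=
  stencil_op (laplace_stencil h).

Definition expi (R : realType) (t : R) : R[i] := cos t +i* sin t.

Definition mode (R : realType) (h theta : R) : grid_fun R :=
  fun j => expi (theta * gridpt h j / h).

Definition is_symbol (R : realType) (h : R) (S : grid_op R) (f : R -> R[i]) :=
  forall (theta : R) (j : int), S (mode h theta) j = f theta * mode h theta j.

(* The value at theta is unique when it exists, since modes do not vanish;
   the default value 0 is used when there is none. *)
Definition symbol (R : realType) (h : R) (S : grid_op R) (theta : R) : R[i] :=
  xget 0 [set z : R[i] |
    forall j : int, S (mode h theta) j = z * mode h theta j].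

(* A patch is a duplicate-free list of grid indices; the order of the list only
   numbers the local unknowns. *)
Definition patch_restr (R : realType) (s : seq int) (u : grid_fun R) :
    'cV[R[i]]_(size s) :=
  \col_a u (nth 0 s a).

Definition patch_ext (R : realType) (s : seq int) (v : 'cV[R[i]]_(size s)) :
    grid_fun R :=
  fun j => \sum_(a < size s | nth 0 s a == j) v a 0.

(* The matrix of V A V^T, column b being the image of the b-th unit vector. *)
Definition patch_mx (R : realType) (s : seq int) (A : grid_op R) :
    'M[R[i]]_(size s) :=
  \matrix_(a, b) patch_restr s (A (patch_ext (delta_mx b 0))) a 0.

Definition patch_count (I : choiceType) (P : I -> seq int) (j : int) : nat :=
  #|` fset_set [set i | j \in P i]|.

Definition patch_weight (R : realType) (I : choiceType) (P : I -> seq int)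
    (i : I) : 'M[R[i]]_(size (P i)) :=
  diag_mx (\row_a ((patch_count P (nth 0 (P i) a))%:R)^-1).

(* The sum over the (possibly infinite) family of patches is pointwise: when
   every grid point lies in finitely many patches, only finitely many terms are
   nonzero at j. *)
Definition vanka (R : realType) (I : choiceType) (P : I -> seq int)
    (A : grid_op R) : grid_op R :=
  fun u j => \sum_(i \in [set: I])
    patch_ext (patch_weight R P i *m invmx (patch_mx (P i) A)
               *m patch_restr (P i) u) j.

Definition vertex_patch (j : int) : seq int := [:: j - 1; j; j + 1].

Definition vertex_vanka (R : realType) (h : R) : grid_op R :=
  vanka vertex_patch (laplace h).

Definition relaxation (R : realType) (M A : grid_op R) (omega : R) : grid_op R :=
  fun u j => u j - omega%:C * M (A u) j.

Definition vertex_relaxation (R : realType) (h omega : R) : grid_op R :=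
  relaxation (vertex_vanka h) (laplace h) omega.

Definition Thigh (R : realType) : set R :=
  `[- (pi / 2), 3 * pi / 2[ `\` `[- (pi / 2), pi / 2[.

Definition is_max (R : realType) (A : set R) (m : R) := A m /\ ubound A m.

Definition is_min (R : realType) (A : set R) (m : R) := A m /\ lbound A m.

Definition cmod (R : realType) (z : R[i]) : R := Normc.normc z.

Definition smoothing_factor (R : realType) (h : R) (S : grid_op R) : R :=
  sup [set cmod (symbol h S theta) | theta in @Thigh R].

(* Main.v *)
Require Import Defs.
From HB Require Import structures.
From mathcomp Require Import all_boot all_order all_algebra finmap complex.
From mathcomp Require Import all_classical all_reals all_analysis.
From mathcomp Require Import ring lra zify.

Set Implicit Arguments.
Unset Strict Implicit.
Unset Printing Implicit Defensive.

Import Order.TTheory GRing.Theory Num.Theory.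

Local Open Scope classical_set_scope.
Local Open Scope ring_scope.
Local Open Scope complex_scope.

(* Inverting the 3 x 3 patch matrix turns M_v into the five-point stencil
   (h^2/12) [1 4 10 4 1], so with c = cos theta the symbol of M_v A_h is
   (2/3) (2 - c^2 - c^3).  The high frequencies are those with c in [-1, 0], on
   which the symbol ranges over [100/81, 4/3], the endpoints being reached at
   c = -2/3 and c = -1.  Hence the smoothing factor of S_v is
   max(|1 - 100/81 omega|, |1 - 4/3 omega|), which is minimal exactly where the
   two terms balance. *)

(** * The discrete Laplacian and uniqueness of symbols *)

Lemma laplaceE (R : realType) (h : R) (u : grid_fun R) (j : int) :
  laplace h u j = (h ^- 2)%:C * (2 * u j - u (j - 1) - u (j + 1)).
Proof.
pose B : {fset int} := [fset (-1)%Z; 0%Z; 1%Z]%fset.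
have sB : (finsupp (laplace_stencil h) `<=` B)%fset.
  exact: finsupp_sub.
rewrite /laplace /stencil_op (big_fset_incl _ sB); last first.
  by move=> x _; rewrite mem_finsupp negbK => /eqP->; rewrite mul0r.
rewrite (perm_big [:: -1; 0; 1]); last first.
  apply: uniq_perm => [|//|x]; first exact: fset_uniq.
  by rewrite !inE orbA.
rewrite !big_cons big_nil.
rewrite /laplace_stencil !fsfunE !inE /=.
rewrite !rmorphM rmorphN rmorph1 rmorph_nat addr0.
by ring.
Qed.

(** Every mode takes the value 1 at index 0, so evaluating there determines the factor. *)
Lemma symbol_unique (R : realType) (h : R) (S : grid_op R) (theta : R) z :
  (forall j, S (mode h theta) j = z * mode h theta j) -> symbol h S theta = z.
Proof.
move=> Sz; apply: xget_unique => // y /(_ 0).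
rewrite Sz /mode /gridpt mul0r mulr0 mul0r /expi cos0 sin0.
by rewrite !mulr1.
Qed.

(** * Vertex patches, their local solves and the resulting stencil *)

Lemma patch_count_vertex j : patch_count vertex_patch j = 3%N.
Proof.
pose B : {fset int} := [fset (j - 1)%R; j; (j + 1)%R]%fset.
rewrite /patch_count.
have -> : [set i | j \in vertex_patch i] = [set` B].
  apply/seteqP; split => x /=; rewrite /vertex_patch !inE => H; lia.
rewrite set_fsetK /B -!fsetUA !cardfsU1 cardfs1 !inE.
lia.
Qed.

Lemma nth_vertex_patch (i : int) (a : 'I_3) :
  nth 0 (vertex_patch i) a = i - 1 + a%:Z.
Proof. case: a => -[|[|[|//]]] ? /=; lia. Qed.

Lemma patch_ext_vertex (R : realType) (i j : int) (v : 'cV[R[i]]_3) :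
  patch_ext (s := vertex_patch i) v j
  = \sum_(a < 3 | i - 1 + a%:Z == j) v a 0.
Proof. by apply: eq_bigl => a; rewrite nth_vertex_patch. Qed.

Lemma patch_ext_delta (R : realType) (i j : int) (b : 'I_3) :
  patch_ext (s := vertex_patch i) (delta_mx b 0 : 'cV[R[i]]_3) j
  = (i - 1 + b%:Z == j)%:R.
Proof.
rewrite patch_ext_vertex big_mkcond (bigD1 b) //= mxE !eqxx big1 ?addr0.
  by case: ifP.
by move=> a /negPf ab; rewrite mxE ab; case: ifP.
Qed.

(** The neighbour tests compare natural numbers, since a successor may leave ['I_3]. *)
Lemma patch_mx_vertex (R : realType) (h : R) (i : int) (a b : 'I_3) :
  (patch_mx (vertex_patch i) (laplace h) : 'M[R[i]]_3) a b
  = (h ^- 2)%:C * (2 * (a == b)%:R - (a == b.+1 :> nat)%N%:R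
                     - (b == a.+1 :> nat)%N%:R).
Proof.
rewrite !mxE nth_vertex_patch laplaceE !patch_ext_delta.
by do !f_equal; apply/idP/idP; rewrite -?val_eqE /=; lia.
Qed.

(* The adjugate of tridiag(-1, 2, -1), whose determinant is 4; rows and columns
   are numbered from 0. *)
Definition adj_tridiag (a b : nat) : nat :=
  nth 0%N (nth [::] [:: [:: 3; 2; 1]; [:: 2; 4; 2]; [:: 1; 2; 3]] a)%N b.

Lemma invmx_vertex (R : realType) (h : R) (i : int) : h != 0 ->
  invmx (patch_mx (vertex_patch i) (laplace h) : 'M[R[i]]_3)
  = \matrix_(a, b) ((h ^+ 2 / 4)%:C * (adj_tridiag a b)%:R).
Proof.
move=> h0; set A := (X in invmx X); set K := (X in _ = X).
have h2 : (h ^+ 2 / 4)%:C * (h ^- 2)%:C = 4^-1 :> R[i].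
  rewrite -rmorphM mulrAC divff ?expf_neq0 // mul1r.
  by rewrite fmorphV rmorph_nat.
(* A left inverse of a square matrix is its inverse, so it suffices to check the nine entries of
   this product. *)
have KA : K *m A = 1%:M.
  apply/matrixP => a b; rewrite [RHS]mxE mxE.
  under eq_bigr => c _ do rewrite [K _ _]mxE patch_mx_vertex mulrACA h2.
  rewrite !big_ord_recl big_ord0 -!val_eqE /=.
  by case: a b => -[|[|[|//]]] ? [] [|[|[|//]]] ? /=;
    rewrite /bump /= ?add1n /adj_tridiag /=; field.
have [_ Au] := mulmx1_unit KA.
by rewrite -[RHS](mulmxK Au) KA mul1mx.
Qed.

(** The 12 is the overlap count 3 times the determinant 4. *)
Lemma local_solve_vertex (R : realType) (h : R) (i : int) (u : grid_fun R)
    (a : 'I_3) : h != 0 ->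
  (patch_weight R vertex_patch i *m
     invmx (patch_mx (vertex_patch i) (laplace h)) *m
     patch_restr (vertex_patch i) u : 'cV[R[i]]_3) a 0
  = (h ^+ 2 / 12)%:C *
    \sum_(b < 3) (adj_tridiag a b)%:R * u (i - 1 + b%:Z).
Proof.
move=> h0.
have -> : patch_weight R vertex_patch i = (3^-1)%:M.
  by apply/matrixP => c d; rewrite !mxE patch_count_vertex.
rewrite invmx_vertex // mul_scalar_mx -scalemxAl mxE mxE.
rewrite mulr_sumr [in RHS]mulr_sumr; apply: eq_bigr => b _.
rewrite !mxE nth_vertex_patch !rmorphM !fmorphV !rmorph_nat /=.
by field.
Qed.

(** The patches centred at [j - 1], [j], [j + 1] contribute the adjugate rows [1 2 3], [2 4 2],
    [3 2 1], each starting one grid point further right; they add up to [1 4 10 4 1]. *)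
Lemma vertex_vankaE (R : realType) (h : R) (u : grid_fun R) (j : int) :
  h != 0 ->
  vertex_vanka h u j = (h ^+ 2 / 12)%:C *
    (10 * u j + 4 * (u (j - 1) + u (j + 1)) + (u (j - 2) + u (j + 2))).
Proof.
move=> h0; rewrite /vertex_vanka /vanka.
(* Lying in each other's patch is symmetric, so [vertex_patch j] also lists the centres of the
   patches containing [j]. *)
rewrite (fsbigE (vertex_patch j)) //=; [|by rewrite !inE; lia|]; last first.
  move=> i _; rewrite !inE => ij; rewrite patch_ext_vertex big1 // => a /eqP.
  by case: a => -[|[|[|//]]] ? /=; lia.
rewrite [X in \big[_/_]_(_ <- X | _) _]/vertex_patch.
rewrite !big_cons big_nil !in_setT /= !patch_ext_vertex.
(* The local number of [j] is 2, 1, 0 in these three patches. *)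
rewrite (big_pred1 (@Ordinal 3 2 isT)); last first.
  by move=> a; rewrite /= -val_eqE /=; lia.
rewrite (big_pred1 (@Ordinal 3 1 isT)); last first.
  by move=> a; rewrite /= -val_eqE /=; lia.
rewrite (big_pred1 (@Ordinal 3 0 isT)); last first.
  by move=> a; rewrite /= -val_eqE /=; lia.
rewrite !local_solve_vertex // !big_ord_recl !big_ord0.
rewrite /lift /bump /= ?add1n /adj_tridiag /=.
have e0 : j - 1 - 1 = j - 2 by ring.
have e1 : j - 1 + 1 = j by ring.
have e2 : j - 1 + 2 = j + 1 by ring.
have e3 : j + 1 - 1 = j by ring.
have e4 : j - 2 + 1 = j - 1 by ring.
have e5 : j - 2 + 2 = j by ring.
rewrite !(e0, e1, e2, e3, e4, e5, addr0).
by ring.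
Qed.

(** * Action on Fourier modes and the symbols *)

Lemma expiD (R : realType) (s t : R) : expi (s + t) = expi s * expi t.
Proof.
by apply/eqP; rewrite eq_complex /= cosD sinD eqxx /= addrC [X in X + _]mulrC.
Qed.

Lemma expiDN (R : realType) (t : R) : expi t + expi (- t) = (2 * cos t)%:C.
Proof.
apply/eqP; rewrite eq_complex /= cosN sinN subrr eqxx andbT.
by apply/eqP; ring.
Qed.

Lemma mode_shift (R : realType) (h theta : R) (j k : int) : h != 0 ->
  mode h theta (j + k) = expi (theta * k%:~R) * mode h theta j.
Proof.
move=> h0; rewrite /mode -expiD /gridpt intrD; congr expi.
by field.
Qed.

(** Both stencils are symmetric, so opposite shifts pair up and the symbols are real. *)
Lemma modeDN (R : realType) (h theta : R) (j k : int) : h != 0 ->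
  mode h theta (j - k) + mode h theta (j + k)
  = (2 * cos (theta * k%:~R))%:C * mode h theta j.
Proof.
by move=> h0; rewrite !mode_shift // intrN mulrN -mulrDl addrC -expiDN.
Qed.

Lemma laplace_mode (R : realType) (h theta : R) (j : int) : h != 0 ->
  laplace h (mode h theta) j
  = (h ^- 2 * (2 - 2 * cos theta))%:C * mode h theta j.
Proof.
move=> h0; rewrite laplaceE -addrA -opprD modeDN // mulr1.
rewrite !(rmorphM, rmorphB, rmorph_nat) /=; ring.
Qed.

Lemma vertex_vanka_mode (R : realType) (h theta : R) (j : int) : h != 0 ->
  vertex_vanka h (mode h theta) j
  = (h ^+ 2 / 3 * (2 + 2 * cos theta + cos theta ^+ 2))%:C * mode h theta j.
Proof.
move=> h0; rewrite vertex_vankaE // !modeDN // mulr1.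
have -> : cos (theta * 2%:~R) = 2 * cos theta ^+ 2 - 1.
  by rewrite mulr_natr mulr2n cosD -!expr2 sin2cos2; ring.
by rewrite !(rmorphM, rmorphD, rmorphN, rmorph_nat, fmorphV, rmorph1) /=; field.
Qed.

Lemma symbol_laplace (R : realType) (h theta : R) : h != 0 ->
  symbol h (laplace h) theta = (h ^- 2 * (2 - 2 * cos theta))%:C.
Proof. by move=> h0; apply: symbol_unique => j; rewrite laplace_mode. Qed.

Lemma symbol_vertex_vanka (R : realType) (h theta : R) : h != 0 ->
  symbol h (vertex_vanka h) theta
  = (h ^+ 2 / 3 * (2 + 2 * cos theta + cos theta ^+ 2))%:C.
Proof. by move=> h0; apply: symbol_unique => j; rewrite vertex_vanka_mode. Qed.

(** With c = cos theta this is (2/3) (1 - c) (2 + 2c + c^2) expanded; the powers of [h] in the two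
    symbols cancel. *)
Definition prod_symbol (R : realType) (theta : R) : R :=
  2 / 3 * (2 - cos theta ^+ 2 - cos theta ^+ 3).

Lemma symbol_product (R : realType) (h omega theta : R) : h != 0 ->
  1 - omega%:C * symbol h (vertex_vanka h) theta * symbol h (laplace h) theta
  = (1 - omega * prod_symbol theta)%:C.
Proof.
move=> h0; rewrite symbol_vertex_vanka // symbol_laplace //.
rewrite -!rmorphM -[X in X - _]/(1%:C) -rmorphB; congr (_%:C).
by rewrite /prod_symbol; field.
Qed.

Lemma vertex_relaxation_mode (R : realType) (h omega theta : R) (j : int) :
  h != 0 ->
  vertex_relaxation h omega (mode h theta) j
  = (1 - omega * prod_symbol theta)%:C * mode h theta j.
Proof.
move=> h0; rewrite /vertex_relaxation /relaxation.
set a := h ^- 2 * (2 - 2 * cos theta).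
(* The mode is an eigenfunction of [laplace h], and the explicit stencil of the Vanka operator lets
   the eigenvalue be pulled out. *)
have -> : vertex_vanka h (laplace h (mode h theta)) j
          = a%:C * vertex_vanka h (mode h theta) j.
  by rewrite !vertex_vankaE // !laplace_mode // -/a; move: a%:C => z; ring.
rewrite vertex_vanka_mode // -(symbol_product _ _ h0).
rewrite symbol_vertex_vanka // symbol_laplace //.
by rewrite -/a; ring.
Qed.

(** * Range of the symbol over the high frequencies *)

Lemma ThighE (R : realType) :
  @Thigh R = [set theta | pi / 2 <= theta < 3 * pi / 2].
Proof.
have := pi_gt0 R => pi0.
apply/seteqP; split => t; rewrite /Thigh /= !in_itv /=; lra.
Qed.

Lemma cos_Thigh (R : realType) (theta : R) :
  Thigh theta -> -1 <= cos theta <= 0.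
Proof.
rewrite ThighE => /= tH; rewrite cos_geN1 /=.
(* Shifting by pi negates the cosine and moves the angle to where cosines are nonnegative. *)
have /cos_ge0_pihalf : - (pi / 2) <= theta - pi <= pi / 2 by lra.
by rewrite cosB cospi sinpi; lra.
Qed.

Lemma prod_symbol_bounds (R : realType) (theta : R) :
  Thigh theta -> 100 / 81 <= prod_symbol theta <= 4 / 3.
Proof.
move=> /cos_Thigh; rewrite /prod_symbol; move: (cos theta) => c cH.
(* [4 / 27 - c ^ 2 - c ^ 3] has the double root [- 2 / 3]. *)
have h1 : 0 <= (c + 2 / 3) ^+ 2 * (1 / 3 - c).
  by apply: mulr_ge0; [exact: sqr_ge0|lra].
(* Two thirds of this is the gap between 4/3 and the symbol. *)
have h2 : 0 <= c ^+ 2 * (1 + c) by apply: mulr_ge0; [exact: sqr_ge0|lra].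
lra.
Qed.

Lemma prod_symbol_pi (R : realType) : prod_symbol (pi : R) = 4 / 3.
Proof. by rewrite /prod_symbol cospi; field. Qed.

Lemma prod_symbol_acos (R : realType) :
  prod_symbol (acos (- (2 / 3)) : R) = 100 / 81.
Proof. by rewrite /prod_symbol acosK ?in_itv /=; [field|lra]. Qed.

Lemma Thigh_pi (R : realType) : Thigh (pi : R).
Proof. rewrite ThighE /=; have := pi_gt0 R; lra. Qed.

Lemma Thigh_acos (R : realType) : Thigh (acos (- (2 / 3)) : R).
Proof.
have r : -1 <= - (2 / 3 : R) <= 1 by apply/andP; split; lra.
have pi0 := pi_gt0 R; have := acos_ge0 r; have := acos_lepi r.
rewrite ThighE /= => le ge; apply/andP; split; last lra.
(* An angle below pi/2 would have positive cosine, not -2/3. *)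
rewrite leNgt; apply/negP => lt.
have : 0 < cos (acos (- (2 / 3) : R)) by apply: cos_gt0_pihalf; lra.
rewrite acosK ?in_itv //=; lra.
Qed.

(** * Minimisation over the relaxation parameter *)

Definition mu (R : realType) (omega : R) : R :=
  Num.max `|1 - omega * (100 / 81)| `|1 - omega * (4 / 3)|.

Lemma mu_boundP (R : realType) (omega : R) :
  (- mu omega <= 1 - omega * (100 / 81) <= mu omega) /\
  (- mu omega <= 1 - omega * (4 / 3) <= mu omega).
Proof.
by apply/andP; rewrite -!ler_norml -ge_max.
Qed.

Lemma is_max_mu (R : realType) (omega : R) :
  is_max [set `|1 - omega * prod_symbol theta| | theta in @Thigh R] (mu omega).
Proof.
split.
  rewrite /mu; case: leP => _.
    by exists pi; [exact: Thigh_pi|rewrite prod_symbol_pi].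
  by exists (acos (- (2 / 3))); [exact: Thigh_acos|rewrite prod_symbol_acos].
move=> _ [theta Ttheta <-]; have /andP[] := prod_symbol_bounds Ttheta.
move: (prod_symbol theta) => x lx ux.
rewrite ler_norml; have [] := mu_boundP omega.
(* The expression is affine in [x]; the sign of [omega] decides which endpoint bounds it from which
   side. *)
by case: (lerP 0 omega) => w0; nra.
Qed.

Lemma is_max_sup (R : realType) (A : set R) (m : R) : is_max A m -> sup A = m.
Proof.
move=> [Am ubm]; apply/le_anti/andP; split.
  by apply: ge_sup => //; exists m.
by apply: ub_le_sup => //; exists m.
Qed.

(** Adding 27 times the upper bound on [1 - omega * (100 / 81)] to 25 times the lower bound on
    [1 - omega * (4 / 3)] eliminates [omega] and leaves 2 <= 52 [mu omega]. *)
Lemma mu_ge (R : realType) (omega : R) : 1 / 26 <= mu omega.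
Proof. by have [] := mu_boundP omega; lra. Qed.

(** At the value 1/26 the first of these bounds gives [omega >= 81 / 104], the second
    [omega <= 81 / 104]. *)
Lemma mu_eq (R : realType) (omega : R) :
  mu omega = 1 / 26 <-> omega = 81 / 104.
Proof.
split=> [m|->]; first by have [] := mu_boundP omega; rewrite m; lra.
apply/le_anti; rewrite mu_ge andbT /mu ge_max !ler_norml; lra.
Qed.

Theorem theorem3p2 (R : realType) (h : R) (h_gt0 : 0 < h) :
  let A := laplace h in
  let M := vertex_vanka h in
  let S := vertex_relaxation h in
  [/\ is_symbol h A (symbol h A) /\ is_symbol h M (symbol h M),
      forall omega : R, is_symbol h (S omega)
        (fun theta => 1 - omega%:C * symbol h M theta * symbol h A theta),
      forall omega : R,
        is_max [set cmod (1 - omega%:C * symbol h M theta * symbol h A theta)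
               | theta in @Thigh R]
               (smoothing_factor h (S omega)),
      is_min [set smoothing_factor h (S omega) | omega in [set: R]] (1 / 26)
    & forall omega : R,
        smoothing_factor h (S omega) = 1 / 26 <-> omega = 81 / 104].
Proof.
move=> /=; have h0 : h != 0 by rewrite gt_eqF.
have cmodE (x : R) : cmod x%:C = `|x|.
  by rewrite /cmod /= expr0n addr0 sqrtr_sqr.
have smoothE omega : smoothing_factor h (vertex_relaxation h omega) = mu omega.
  (* The supremum is attained, so the maximum computed above is the smoothing factor. *)
  apply: is_max_sup; under eq_imagel => theta _.
    rewrite (symbol_unique (fun j => vertex_relaxation_mode omega theta j h0)).
    rewrite cmodE.
    over.
  exact: is_max_mu.
split.
- split=> theta j.
    by rewrite symbol_laplace // laplace_mode.
  by rewrite symbol_vertex_vanka // vertex_vanka_mode.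
- by move=> omega theta j; rewrite symbol_product // vertex_relaxation_mode.
- move=> omega; rewrite smoothE.
  under eq_imagel => theta _ do rewrite symbol_product // cmodE.
  exact: is_max_mu.
- split; last by move=> _ [omega _ <-]; rewrite smoothE mu_ge.
  by exists (81 / 104) => //; rewrite smoothE; apply/mu_eq.
- by move=> omega; rewrite smoothE; exact: mu_eq.
Qed.
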